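(* Let $n\in 4\mathbb{N}$ be a positive integer. The number of integral oriented circulant graphs $\mathrm{IOCG}_n(\mathbf{D},\sigma)$ of order $n$ having perfect state transfer is $$2\times 3^{\tau\left(\frac n4\right)-\tau\left(\frac{n}{2^{\vartheta_2(n)}}\right)},$$ where $\tau(x)$ denotes the number of positive divisors of $x$.
   Context: Let $n$ be a positive integer with $n\equiv 0\pmod 4$. For a positive divisor $d$ of $n/4$ and $r\in\{1,3\}$ let $G_n^r(d)=\{dk : k\equiv r \pmod 4,\ \gcd(dk,n)=d\}$, regarded as a subset of $\mathbb{Z}_n$. Given a nonempty set $\mathbf{D}$ of positive divisors of $n/4$ and a map $\sigma:\mathbf{D}\to\{1,-1\}$, put $S_n(d)=G_n^1(d)$ if $\sigma(d)=1$, $S_n(d)=G_n^3(d)$ if $\sigma(d)=-1$, and $\mathcal{C}=\bigcup_{d\in\mathbf{D}}S_n(d)$. Then $\mathrm{IOCG}_n(\mathbf{D},\sigma)$ is the oriented graph with vertex set $\mathbb{Z}_n$ and arc set $\{(a,b): b-a\in\mathcal{C}\}$; the (nonempty) integral oriented circulant graphs, i.e. those whose Hermitian adjacency matrix has only integer eigenvalues, are exactly these graphs. Graphs are counted as pairs $(\mathbf{D},\sigma)$ (equivalently, by their symbol $\mathcal{C}$), not up to isomorphism. The Hermitian adjacency matrix $H=(h_{uv})$ of an oriented graph has $h_{uv}=\mathrm{i}$ if $(u,v)$ is an arc, $h_{uv}=-\mathrm{i}$ if $(v,u)$ is an arc, and $h_{uv}=0$ otherwise, where $\mathrm{i}=\sqrt{-1}$.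 Let $U(t)=\exp(\mathrm{i}tH)$ and let $\mathbf{e}_u$ be the standard basis vector indexed by the vertex $u$. The graph has perfect state transfer from $u$ to $v$ if there are $t\in\mathbb{R}$ and a complex number $\gamma$ with $|\gamma|=1$ such that $U(t)\mathbf{e}_u=\gamma\mathbf{e}_v$. The graph has perfect state transfer if this happens for some two distinct vertices $u,v$. For a positive integer $x$, $\vartheta_2(x)$ is the exponent of the largest power of $2$ dividing $x$. *)

(* Defs.v *)
From mathcomp Require Import all_boot all_order all_algebra.
From mathcomp Require Import complex.
From mathcomp Require Import boolp classical_sets reals topology normedtype sequences.

Set Implicit Arguments.
Unset Strict Implicit.
Unset Printing Implicit Defensive.

Import Order.TTheory GRing.Theory Num.Theory.
Import numFieldNormedType.Exports.

Local Open Scope ring_scope.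
Local Open Scope complex_scope.

(** * Integral oriented circulant graphs *)

(* G_n^r(d), with k ranging over all of Z and d * k read modulo n. For n >= 2,
   'Z_n is Z/nZ; below n is always a positive multiple of 4. *)
Definition Gset (n r d : nat) : {set 'Z_n} :=
  finset (fun x : 'Z_n =>
    `[< exists k : int,
          [/\ (k = r%:Z %[mod 4])%Z,
              gcdz (d%:Z * k) n%:Z = d%:Z
            & x = (d%:Z * k)%:~R ] >]).

Definition divisor (n : nat) : finType := seq_sub (divisors n).

Definition pm1 : finType := seq_sub [:: 1%:Z; -1].

(* The pairs (D, sigma), D a set of positive divisors of n/4 (possibly empty
   here) and sigma : D -> {1, -1}. *)
Definition iocg_data (n : nat) : finType :=
  {D : {set divisor (n %/ 4)} & {ffun {d | d \in D} -> pm1}}.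

Definition Sset (n d : nat) (s : int) : {set 'Z_n} :=
  if s == 1 then Gset n 1 d else Gset n 3 d.

Definition symbol (n : nat) (G : iocg_data n) : {set 'Z_n} :=
  (\bigcup_(d : {d | d \in tag G}) Sset n (ssval (val d)) (ssval (tagged G d)))%SET.

Definition iocg (n : nat) (G : iocg_data n) : rel 'Z_n :=
  fun a b => b - a \in symbol G.

(** * Perfect state transfer *)

Section StateTransfer.
Variable R : realType.
Local Notation C := R[i].
Local Notation iC := ('i%C : C).

(* The matrix exponential, as the entrywise sum of the power series; the
   annotation C^o gives access to the topology of the field C. *)
Definition expmx (m : nat) (A : 'M[C]_m) : 'M[C]_m :=
  \matrix_(u, v)
    lim (series (fun k : nat => (k`!%:R^-1 *: A ^+ k) u v : C^o) @ \oo)%classic.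

Definition hermitian_adjacency (m : nat) (e : rel 'I_m) : 'M[C]_m :=
  \matrix_(u, v) (if e u v then iC else if e v u then - iC else 0).

Definition transition (m : nat) (e : rel 'I_m) (t : R) : 'M[C]_m :=
  expmx ((iC * t%:C) *: hermitian_adjacency e).

Definition pst_between (m : nat) (e : rel 'I_m) (u v : 'I_m) : Prop :=
  exists (t : R) (gamma : C),
    `|gamma| = 1 /\
    transition e t *m (delta_mx u 0 : 'cV[C]_m) = gamma *: delta_mx v 0.

Definition has_pst (m : nat) (e : rel 'I_m) : Prop :=
  exists u v : 'I_m, u != v /\ pst_between e u v.

End StateTransfer.

Definition tau (x : nat) : nat := size (divisors x).

(* Main.v *)
From mathcomp Require Import complex.
From mathcomp Require Import classical_sets topology normedtype sequences.
Require Import Defs.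
From mathcomp Require Import all_boot all_order all_algebra.
From mathcomp Require Import boolp reals trigo.
From mathcomp Require Import ring lra zify.

(** Write n = 4 M and let chi be the nontrivial Dirichlet character modulo 4.
    Extend sigma by 0 to all integers.  For z in Z/n and g = gcd(z, n), the
    number s(z) = sigma(g) chi(z / g) is 1 if z is in the symbol C, -1 if -z is,
    and 0 otherwise ([mem_symbol], [weightN]).  So H is i times a circulant
    matrix of signs, and its eigenvalues are Fourier sums of these signs.

    Such a sum would expand into Gauss and Ramanujan sums.  Instead sigma is
    written as a Dirichlet convolution, sigma(d) = sum_{e | d} chi(d / e) a(e),
    which is a triangular system for a ([chi4_inversion]).  As chi is
    completely multiplicative, the signs become sum_{e | M, e | x}
    chi(x / e) a(e) ([weight_conv]), and each e contributes a geometric sum.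
    The result ([fourier_conv]) is the integer eigenvalue

      lambda_j = -2 L_j,   L_j = sum over e | M with (M / e) | j
                                 of (M / e) chi(j / (M / e)) a(e).

    Modulo 2, L_j vanishes for even j, and for odd j it is the sum of the a(e)
    with M / e a divisor of j.  The triangular passages between sigma, a and L
    then show that L_j = c mod 2 for all odd j exactly when, among the divisors
    d of M with M / d odd, sigma(d) is c mod 2 at d = M and even elsewhere.

    Diagonalizing exp(itH) by the discrete Fourier transform, a transfer from u
    to v at time t means exp(-2it L_j) = gamma zeta^j for all j, where
    zeta = w^(u - v) and w is the primitive n-th root of unity
    ([pst_betweenP]).

    - If the support D of sigma meets the divisors with odd codivisor in M only,
      L_j and j have the same parity, and t = pi / 2 up to sign transfers 0 to
      n / 2.
    - Conversely, gamma = 1 because L_0 = 0.  If m is the odd part of M, then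
      L_(j+2m) = - L_j for odd j, which forces zeta^4 = 1; so at t or at 2t all
      odd j give -1.  Hence the L_j with j odd have a common parity c.  If c = 0,
      then sigma, being even with values 0, 1, -1, vanishes at all d with M / d
      odd, and L_j = 0 gives 1 = -1.  So c = 1, which is the condition above.

    Therefore ([has_pstP]) the graphs are counted by choosing one of 2 signs at
    M, one of 3 states (absent, or present with one of 2 signs) at each d with
    M / d even, all other d being absent; and the d with M / d odd correspond to
    the divisors of the odd part of n. *)

Set Implicit Arguments.
Unset Strict Implicit.
Unset Printing Implicit Defensive.

Import Order.TTheory GRing.Theory Num.Theory.
Import numFieldNormedType.Exports.

(** * Divisors, parity and the character modulo 4 *)

(** An odd divisor of [M] is prime to the 2-part of [M], so it divides the
    other factor. *)
Lemma dvdn_oddpart M q : (0 < M)%N -> (q %| M`_2^') = (q %| M) && odd q.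
Proof.
move=> M_gt0; have [->|q_gt0] := posnP q.
  by rewrite dvd0n andbF; have := part_gt0 2^' M; case: (M`_2^').
apply/idP/andP => [qm|[qM oq]].
  split; first exact: dvdn_trans qm (dvdn_part _ _).
  by have := pnat_dvd qm (part_pnat _ _); rewrite p'natE // dvdn2 negbK.
have q2 : 2^'.-nat q by rewrite p'natE // dvdn2 oq.
by rewrite -(part_pnat_id q2) partn_dvd.
Qed.

Section Parity.
Local Open Scope ring_scope.

Definition chi4 (k : nat) : int :=
  if (k %% 4 == 1)%N then 1 else if (k %% 4 == 3)%N then -1 else 0.

Lemma chi4M k l : chi4 (k * l) = chi4 k * chi4 l.
Proof.
rewrite /chi4 -modnMm.
by have := ltn_pmod k (isT : 0 < 4)%N; have := ltn_pmod l (isT : 0 < 4)%N;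
   case: (k %% 4)%N => [|[|[|[|?]]]] //; case: (l %% 4)%N => [|[|[|[|?]]]].
Qed.

Lemma odd_mod4 k : odd k = odd (k %% 4).
Proof. by rewrite {1}(divn_eq k 4) oddD oddM andbF. Qed.

Lemma chi4_even k : ~~ odd k -> chi4 k = 0.
Proof.
rewrite /chi4 odd_mod4; have := ltn_pmod k (isT : 0 < 4)%N.
by case: (k %% 4)%N => [|[|[|[|?]]]].
Qed.

Lemma chi4_odd k : odd k -> chi4 k = 1 \/ chi4 k = -1.
Proof.
rewrite /chi4 odd_mod4; have := ltn_pmod k (isT : 0 < 4)%N.
by case: (k %% 4)%N => [|[|[|[|?]]]] // _ _; [left|right].
Qed.

Lemma chi4D2 k l : odd k -> odd l -> chi4 (k + 2 * l) = - chi4 k.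
Proof.
rewrite /chi4 [odd k]odd_mod4 [odd l]odd_mod4 -modnDm -modnMm.
by have := ltn_pmod k (isT : 0 < 4)%N; have := ltn_pmod l (isT : 0 < 4)%N;
   case: (k %% 4)%N => [|[|[|[|?]]]] //; case: (l %% 4)%N => [|[|[|[|?]]]].
Qed.

(** Used with k = x / g and l = (n - x) / g, it makes the weights below odd. *)
Lemma chi4_opp k l q : (k + l = 4 * q)%N -> chi4 l = - chi4 k.
Proof.
move=> klE; have : ((k %% 4 + l %% 4) %% 4 = 0)%N.
  by rewrite modnDm klE modnMr.
rewrite /chi4.
by have := ltn_pmod k (isT : 0 < 4)%N; have := ltn_pmod l (isT : 0 < 4)%N;
   case: (k %% 4)%N => [|[|[|[|?]]]] //; case: (l %% 4)%N => [|[|[|[|?]]]].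
Qed.

Lemma odd_quotient M d e :
  (d %| M)%N -> (e %| d)%N -> odd (M %/ d) -> odd (d %/ e) -> odd (M %/ e).
Proof.
by move=> dM ed o1 o2; rewrite -(divnK dM) -muln_divA // oddM o1.
Qed.

Lemma F2_natr k : k%:R = (odd k)%:R :> 'F_2.
Proof.
rewrite -[in LHS](odd_double_half k) natrD -muln2 natrM.
by have -> : 2%:R = 0 :> 'F_2; [exact: val_inj | rewrite mulr0 addr0].
Qed.

Lemma F2_chi4 k : (chi4 k)%:~R = (odd k)%:R :> 'F_2.
Proof.
have [o|e] := boolP (odd k); last by rewrite chi4_even.
by case: (chi4_odd o) => -> //; apply: val_inj.
Qed.

(** Parities are computed in the field with two elements, where both factors
    of a term of the eigenvalue reduce to indicators of oddness. *)
Lemma F2_weight q k : (q%:Z * chi4 k)%:~R = (odd (q * k))%:R :> 'F_2.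
Proof. by rewrite rmorphM /= F2_chi4 -pmulrn (F2_natr q) -natrM mulnb -oddM. Qed.

(** The Dirichlet convolution of [chi4] and [a], restricted to divisors of [M]
    so that it makes sense for every [x], including 0 and numbers that do not
    divide [M]. *)
Definition chi4_conv (M : nat) (a : nat -> int) (x : nat) : int :=
  \sum_(e < M.+1 | (e %| M)%N && (e %| x)%N) chi4 (x %/ e) * a e.

Section Inversion.
Variables (M : nat) (M_gt0 : (0 < M)%N).

(** The equations for d = 1, 2, ... form a unitriangular system, because
    the term e = d has coefficient chi4 1 = 1; so they can be solved one after
    the other over the integers. *)
Lemma chi4_inversion (v : nat -> int) : exists a : nat -> int,
  forall d, (d %| M)%N -> v d = chi4_conv M a d.
Proof.
suff /(_ M) [a aE] : forall N, exists a : nat -> int, forall d,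
    (d <= N)%N -> (d %| M)%N -> v d = chi4_conv M a d.
  by exists a => d dM; apply: aE => //; exact: dvdn_leq.
elim=> [|N [a aE]].
  by exists (fun=> 0) => d; rewrite leqn0 => /eqP ->; rewrite dvd0n; lia.
(* The values on 1 .. N are kept; the equation at N + 1 has coefficient
   chi4 1 = 1 at a (N + 1), so it can be solved for that value. *)
pose rest := \sum_(e < M.+1 | (e %| M)%N && (e %| N.+1)%N && (e != N.+1 :> nat))
  chi4 (N.+1 %/ e) * a e.
exists (fun e => if e == N.+1 then v N.+1 - rest else a e) => d dN dM.
have d_gt0 : (0 < d)%N by exact: dvdn_gt0 dM.
move: dN; rewrite leq_eqVlt ltnS => /orP[/eqP dE|dN]; last first.
  rewrite aE // /chi4_conv; apply: eq_bigr => e /andP[_ ed].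
  by case: eqP => // eN; have := dvdn_leq d_gt0 ed; lia.
subst d.
have NM : (N.+1 < M.+1)%N by rewrite ltnS; exact: dvdn_leq.
rewrite /chi4_conv (bigD1 (Ordinal NM)) /=; last by rewrite dM dvdnn.
rewrite eqxx divnn /= mul1r -[LHS](subrK rest).
by congr (_ + _); apply: eq_bigr => e /andP[_ /negPf] ->.
Qed.

(** Up to the factor -2, the j-th eigenvalue of the graph whose signs are the
    convolution of [chi4] and [a]; see [fourier_conv] and [adjacency_dft]. *)
Definition half_eigen (a : nat -> int) (j : nat) : int :=
  \sum_(e < M.+1 | (e %| M)%N && (M %/ e %| j)%N)
     (M %/ e)%:Z * chi4 (j %/ (M %/ e)) * a e.

Lemma half_eigen0 a : half_eigen a 0 = 0.
Proof. by apply: big1 => e _; rewrite div0n mulr0 mul0r. Qed.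

(** The two factors M / e and j / (M / e) of a term have product j, so one of
    them is even. *)
Lemma half_eigen_even a j : ~~ odd j -> (half_eigen a j)%:~R = 0 :> 'F_2.
Proof.
move=> ej; rewrite rmorph_sum big1 //= => e /andP[_ qj].
rewrite rmorphM /= F2_weight.
by rewrite mulnC divnK // (negPf ej) mul0r.
Qed.

Lemma half_eigen_odd a j : odd j ->
  (half_eigen a j)%:~R = \sum_(e < M.+1 | (e %| M)%N && (M %/ e %| j)%N) (a e)%:~R :> 'F_2.
Proof.
move=> oj; rewrite rmorph_sum; apply: eq_bigr => e /andP[_ qj].
rewrite rmorphM /= F2_weight.
by rewrite mulnC divnK // oj mul1r.
Qed.

(** Only odd q = M / e occur in [half_eigen a j] for odd j, and these divide
    m; hence j and j + 2 m have the same such divisors q, and (j + 2 m) / q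
    differs from j / q by twice an odd number, which changes the sign of
    [chi4]. *)
Lemma half_eigen_antiperiod a m j : odd m -> odd j ->
  (forall q, (q %| M)%N -> odd q -> (q %| m)%N) -> half_eigen a (j + 2 * m) = - half_eigen a j.
Proof.
move=> om oj qm.
have oj2 : odd (j + 2 * m) by rewrite oddD oddM oj.
rewrite /half_eigen -sumrN; apply: eq_big => [e|e /andP[eM qj]].
  case: (boolP (e %| M)%N) => //= eM; apply/idP/idP => qj.
    have h : (M %/ e %| 2 * m)%N by rewrite dvdn_mull // qm ?dvdn_div // (dvdn_odd qj).
    by rewrite -(dvdn_addl _ h).
  by rewrite dvdn_addl // dvdn_mull // qm ?dvdn_div // (dvdn_odd qj).
have oq : odd (M %/ e) by exact: dvdn_odd qj oj2.
have qm' : (M %/ e %| m)%N by rewrite qm ?dvdn_div.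
move: qj; rewrite dvdn_addl ?dvdn_mull // => qj.
rewrite divnDl // -muln_divA // chi4D2 ?mulrN ?mulNr //.
  exact: dvdn_odd (dvdn_div qj) oj.
exact: dvdn_odd (dvdn_div qm') om.
Qed.

Section Support.
Variables (v a : nat -> int).
Hypothesis vE : forall d, (d %| M)%N ->
  v d = chi4_conv M a d.

(** If M / d is odd, the equation at d involves only the e dividing d with
    d / e odd, for which M / e is odd again; so the system restricts to these d
    and is still unitriangular.  The target ring is a parameter because the
    statement is used both modulo 2 and, with [c = 0], over the integers. *)
Lemma coef_of_value (S : nzRingType) (c : S) :
  (forall d, (d %| M)%N -> odd (M %/ d) -> (v d)%:~R = c *+ (d == M)) ->
  forall d, (d %| M)%N -> odd (M %/ d) -> (a d)%:~R = c *+ (d == M).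
Proof.
move=> vc d; elim/ltn_ind: d => d IH dM od.
have d_gt0 : (0 < d)%N by exact: dvdn_gt0 dM.
have dM1 : (d < M.+1)%N by rewrite ltnS; exact: dvdn_leq.
rewrite -vc // vE // /chi4_conv (bigD1 (Ordinal dM1)) /= ?dM ?dvdnn // divnn d_gt0.
rewrite mul1r rmorphD rmorph_sum big1 ?addr0 //= => e /andP[/andP[eM ed]].
rewrite -val_eqE /= => ne; rewrite rmorphM /=.
have [o|/chi4_even ->] := boolP (odd (d %/ e)); last by rewrite mul0r.
have led : (e < d)%N by rewrite ltn_neqAle ne dvdn_leq.
rewrite IH //; last exact: odd_quotient ed od o.
by have -> : (e == M :> nat) = false; [apply/eqP; lia | rewrite mulr0].
Qed.

Lemma value_of_coef (c : 'F_2) :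
  (forall d, (d %| M)%N -> odd (M %/ d) -> (a d)%:~R = c *+ (d == M)) ->
  forall d, (d %| M)%N -> odd (M %/ d) -> (v d)%:~R = c *+ (d == M).
Proof.
move=> ac d dM od; rewrite vE // /chi4_conv rmorph_sum /=.
have d_gt0 : (0 < d)%N by exact: dvdn_gt0 dM.
have dM1 : (d < M.+1)%N by rewrite ltnS; exact: dvdn_leq.
rewrite (bigD1 (Ordinal dM1)) /= ?dM ?dvdnn // divnn d_gt0 mul1r ac //.
rewrite big1 ?addr0 // => e /andP[/andP[eM ed]].
rewrite -val_eqE /= => ne; rewrite rmorphM /=.
have [o|/chi4_even ->] := boolP (odd (d %/ e)); last by rewrite mul0r.
have led : (e < d)%N by rewrite ltn_neqAle ne dvdn_leq.
rewrite ac //; last exact: odd_quotient ed od o.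
by have -> : (e == M :> nat) = false; [apply/eqP; lia | rewrite mulr0].
Qed.

(** For odd j only the e with M / e odd contribute, and among them only e = M
    has a nonzero coefficient, with M / e = 1 a divisor of every j. *)
Lemma half_eigen_of_coef (c : 'F_2) :
  (forall d, (d %| M)%N -> odd (M %/ d) -> (a d)%:~R = c *+ (d == M)) ->
  forall j, odd j -> (half_eigen a j)%:~R = c.
Proof.
move=> ac j oj; rewrite half_eigen_odd //.
rewrite (bigD1 ord_max) /=; last by rewrite dvdnn divnn M_gt0 dvd1n.
rewrite ac ?dvdnn // ?divnn ?M_gt0 // eqxx.
rewrite big1 ?addr0 // => e /andP[/andP[eM qj]]; rewrite -val_eqE /= => /negPf ne.
by rewrite ac ?ne // (dvdn_odd qj).
Qed.

(** The values at j = q, for q odd dividing [M], are the sums of the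
    coefficients over the divisors of q: again a unitriangular system, now
    solved by induction on q = M / d. *)
Lemma coef_of_half_eigen (c : 'F_2) :
  (forall j, odd j -> (half_eigen a j)%:~R = c) ->
  forall d, (d %| M)%N -> odd (M %/ d) -> (a d)%:~R = c *+ (d == M).
Proof.
move=> Lc d dM; have [q qE] : exists q, q = (M %/ d)%N by exists (M %/ d)%N.
rewrite -qE; elim/ltn_ind: q => q IH in d dM qE * => oq.
have dM1 : (d < M.+1)%N by rewrite ltnS; exact: dvdn_leq.
have q_gt0 : (0 < q)%N by exact: odd_gt0.
(* The constant c is itself the sum of the expected coefficients, so the
   differences have all their divisor sums equal to 0. *)
pose P (e : 'I_M.+1) := (e %| M)%N && (M %/ e %| q)%N.
have sum_a : \sum_(e | P e) (a e)%:~R = c by rewrite -half_eigen_odd // Lc.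
have sum_c : \sum_(e < M.+1 | P e) c *+ (e == M :> nat) = c.
  rewrite (bigD1 ord_max) /= ?eqxx; last by rewrite /P dvdnn divnn M_gt0 dvd1n.
  by rewrite big1 ?addr0 // => e /andP[_]; rewrite -val_eqE /= => /negPf ->.
have : \sum_(e | P e) ((a e)%:~R - c *+ (e == M :> nat)) = 0.
  by rewrite sumrB sum_a sum_c subrr.
rewrite (bigD1 (Ordinal dM1)) /=; last by rewrite /P /= dM -qE dvdnn.
rewrite big1 ?addr0 => [/eqP|e /andP[/andP[eM eq]]]; first by rewrite subr_eq0 => /eqP.
rewrite -val_eqE /= => ne; apply/eqP; rewrite subr_eq0; apply/eqP.
apply: (IH (M %/ e)%N) => //; last exact: dvdn_odd eq oq.
rewrite ltn_neqAle (dvdn_leq q_gt0 eq) andbT.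
apply: contraNneq ne => eqE; apply/eqP.
have := divnK eM; rewrite eqE qE => h; have := divnK dM; rewrite -{2}h.
by move/eqP; rewrite eqn_pmul2l -?qE // => /eqP.
Qed.

Lemma half_eigen_eq0 : (forall d, (d %| M)%N -> odd (M %/ d) -> v d = 0) ->
  forall j, odd j -> half_eigen a j = 0.
Proof.
move=> v0; have a0 d : (d %| M)%N -> odd (M %/ d) -> a d = 0.
  move=> dM od; have := @coef_of_value int 0 _ d dM od; rewrite mul0rn intz; apply.
  by move=> e eM oe; rewrite v0 // mul0rn.
move=> j oj; apply: big1 => e /andP[eM qj].
by rewrite a0 ?mulr0 // (dvdn_odd qj).
Qed.

End Support.
End Inversion.

End Parity.

(** * Fourier transform of a convolution with the character modulo 4 *)

Section GaussSums.
Local Open Scope ring_scope.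

Lemma sum_multiples (V : nmodType) (e K : nat) (F : nat -> V) : (0 < e)%N ->
  \sum_(0 <= x < K * e | (e %| x)%N) F x = \sum_(0 <= y < K) F (y * e)%N.
Proof.
move=> e0; elim: K => [|K IH]; first by rewrite mul0n !big_geq.
rewrite big_nat_recr //= -IH (@big_cat_nat _ _ _ (K * e)) ?leq_pmul2r //=.
congr (_ + _); rewrite big_ltn_cond ?ltn_pmul2r // dvdn_mull //.
rewrite big_nat_cond big1 ?addr0 // => x /andP[/andP[lo hi] /dvdnP[k xE]].
by move: lo hi; rewrite xE !ltn_pmul2r //; lia.
Qed.

Lemma sum_roots_of_unity (F : fieldType) (z : F) n :
  z ^+ n = 1 -> \sum_(0 <= l < n) z ^+ l = if z == 1 then n%:R else 0.
Proof.
move=> zn; case: eqP => [->|/eqP z1].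
  by under eq_bigr do rewrite expr1n; rewrite sumr_const_nat subn0.
have := subrX1 z n; rewrite zn subrr big_mkord => /esym/eqP.
by rewrite mulf_eq0 subr_eq0 (negPf z1) => /eqP.
Qed.

(** Only y = 1 and y = 3 modulo 4 count, with opposite signs: a geometric
    series of ratio z ^ 4. *)
Lemma chi4_sum_split (S : comNzRingType) (z : S) q :
  \sum_(0 <= y < 4 * q) (chi4 y)%:~R * z ^+ y =
  (z - z ^+ 3) * \sum_(0 <= l < q) (z ^+ 4) ^+ l.
Proof.
elim: q => [|q IH]; first by rewrite muln0 !big_geq // mulr0.
have -> : (4 * q.+1 = (4 * q).+4)%N by lia.
rewrite !big_nat_recr //= IH mulrDr -!addrA; congr (_ + _).
have chi4E k : chi4 (4 * q + k) = chi4 k by rewrite /chi4 mulnC modnMDl.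
rewrite -[(4 * q).+3]addn3 -[(4 * q).+2]addn2 -[(4 * q).+1]addn1.
rewrite -[in chi4 (4 * q)%N](addn0 (4 * q)%N) !chi4E -exprM !(exprD z (4 * q)%N) /chi4 /=.
ring.
Qed.

Section Gauss.
Variables (F : fieldType) (n M : nat) (w : F).
Hypotheses (M_gt0 : (0 < M)%N) (nM : n = (4 * M)%N) (prim_w : n.-primitive_root w).

Let i0 := w ^+ M.

(** The square of [w ^+ M] is the square root of 1 other than 1. *)
Lemma quarter_root_sqr : i0 ^+ 2 = -1.
Proof.
have h : (i0 ^+ 2) ^+ 2 == 1.
  by rewrite -exprM -exprM -(prim_expr_order prim_w) nM mulnC.
have : i0 ^+ 2 != 1.
  rewrite -exprM -(prim_order_dvd prim_w); apply/negP => /dvdn_leq.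
  by lia.
by move: h; rewrite sqrf_eq1 => /orP[->//|/eqP].
Qed.

Lemma quarter_root_chi4 k : i0 ^+ k - (i0 ^+ k) ^+ 3 = 2 * i0 * (chi4 k)%:~R.
Proof.
have i2 := quarter_root_sqr.
have i4 : i0 ^+ 4 = 1 by rewrite (exprM _ 2 2) i2 sqrrN expr1n.
rewrite -(expr_mod k i4) -exprM /chi4.
have := ltn_pmod k (isT : 0 < 4)%N.
have i3 : i0 ^+ 3 = - i0 by rewrite exprS i2 mulrN1.
case: (k %% 4)%N => [|[|[|[|?]]]] //= _.
- by rewrite !expr0; ring.
- by rewrite expr1 i3; ring.
- by rewrite (exprM _ 2 3) i2 -signr_odd; ring.
- by rewrite (exprM _ 3 3) i3 exprNn i3 -signr_odd; ring.
Qed.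

(** The geometric series of ratio w ^ (4 j e) vanishes unless n divides 4 j e,
    that is unless M / e divides j; otherwise all its terms are 1 and
    w ^ (j e) is a power of the fourth root of unity [i0]. *)
Lemma chi4_sum e j : (e %| M)%N ->
  \sum_(0 <= y < 4 * (M %/ e)) (chi4 y)%:~R * (w ^+ (j * e)) ^+ y =
  if (M %/ e %| j)%N then 2 * i0 * ((M %/ e)%:Z * chi4 (j %/ (M %/ e)))%:~R else 0.
Proof.
move=> eM; rewrite chi4_sum_split.
have e_gt0 : (0 < e)%N by exact: dvdn_gt0 eM.
have qe : (M %/ e * e = M)%N by exact: divnK.
set q := (M %/ e)%N in qe *.
rewrite sum_roots_of_unity; last first.
  rewrite -!exprM; apply/eqP; rewrite -(prim_order_dvd prim_w) nM -qe.
  by apply/dvdnP; exists j; ring.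
rewrite -!exprM -(prim_order_dvd prim_w) nM -qe.
have -> : (4 * (q * e) %| j * e * 4)%N = (q %| j)%N.
  by rewrite mulnC dvdn_pmul2r // dvdn_pmul2r.
case: ifP => [/dvdnP[k ->]|_]; last by rewrite mulr0.
have q_gt0 : (0 < q)%N by rewrite divn_gt0 // dvdn_leq.
have -> : (k * q * e = M * k)%N by rewrite -qe; ring.
by rewrite !exprM -[w ^+ M]/i0 quarter_root_chi4 mulnK // rmorphM /= -pmulrn; ring.
Qed.

Lemma order_split e : (e %| M)%N -> n = (4 * (M %/ e) * e)%N.
Proof. by move=> eM; rewrite -mulnA divnK. Qed.

(** Exchanging the sums over x and e leaves, for each e, a sum over the
    multiples of e, which [chi4_sum] evaluates. *)
Lemma fourier_conv (a f : nat -> int) j :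
  (forall x, f x = chi4_conv M a x) ->
  \sum_(0 <= x < n) (f x)%:~R * w ^+ (j * x) = 2 * i0 * (half_eigen M a j)%:~R.
Proof.
move=> fE.
under eq_bigr => x _ do rewrite fE /chi4_conv rmorph_sum big_distrl /=.
rewrite (exchange_big_dep (fun e : 'I_M.+1 => (e %| M)%N)) /=; last first.
  by move=> x e _ /andP[].
rewrite /half_eigen rmorph_sum mulr_sumr big_mkcondr /=; apply: eq_bigr => e eM.
have e_gt0 : (0 < e)%N by exact: dvdn_gt0 eM.
transitivity (\sum_(0 <= x < n | (e %| x)%N)
    (a e)%:~R * ((chi4 (x %/ e))%:~R * w ^+ (j * x))).
  by apply: eq_big => [x|x _]; rewrite ?eM // rmorphM /=; ring.
rewrite -mulr_sumr (order_split eM) sum_multiples //.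
under eq_bigr => y _ do rewrite mulnK // [(y * e)%N]mulnC mulnA exprM.
rewrite chi4_sum //; case: ifP => _; last by rewrite mulr0.
by rewrite [in RHS]rmorphM /=; ring.
Qed.
End Gauss.

End GaussSums.

(** * Matrix exponentials by diagonalization *)

Section Exponential.
Local Open Scope ring_scope.
Local Open Scope complex_scope.

Section Cis.
Variable R : realType.
Local Notation C := R[i].

Definition cis (x : R) : C := cos x +i* sin x.

Lemma cisD x y : cis (x + y) = cis x * cis y.
Proof. by rewrite /cis cosD sinD; simpc; congr (_ +i* _); rewrite addrC. Qed.

Lemma cis0 : cis 0 = 1. Proof. by rewrite /cis cos0 sin0. Qed.

Lemma cisMn x k : cis (x *+ k) = cis x ^+ k.
Proof. by elim: k => [|k IH]; rewrite ?cis0 // mulrS exprS cisD IH. Qed.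

Lemma cisN x : cis (- x) = (cis x)^-1.
Proof.
have h : cis (- x) * cis x = 1 by rewrite -cisD addNr cis0.
have nz : cis x != 0.
  by apply: contra_eq_neq h => ->; rewrite mulr0 eq_sym oner_neq0.
by apply: (mulIf nz); rewrite h mulVf.
Qed.

Lemma cis_pi : cis pi = -1.
Proof. by rewrite /cis cospi sinpi; apply/eqP; rewrite eq_complex /= oppr0 !eqxx. Qed.

Lemma cis_pihalf : cis (pi / 2) = 'i%C.
Proof. by rewrite /cis cos_pihalf sin_pihalf. Qed.

(** If cos x = 1, the duplication formula gives sin (x / 2) = 0, while x / 2
    lies strictly between 0 and pi. *)
Lemma cis_eq1 (x : R) : 0 < x < pi *+ 2 -> cis x != 1.
Proof.
move=> /andP[x0 x2]; apply/eqP => -[+ _].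
have -> : x = (x / 2) *+ 2 by rewrite -mulr_natr divfK ?pnatr_eq0.
rewrite cos_mulr2n => h.
have c1 : cos (x / 2) ^+ 2 = 1.
  move: (cos _ ^+ 2) h => y h.
  lra.
have : 0 < sin (x / 2).
  apply: sin_gt0_pi; rewrite divr_gt0 //= ltr_pdivrMr //.
  by rewrite mulr_natr.
by have /eqP := sin2cos2 (x / 2); rewrite c1 subrr sqrf_eq0 => /eqP ->; rewrite ltxx.
Qed.

(** The modulus is at most the sum of the absolute values of the two parts. *)
Lemma cvg_complex (f g : R^nat) (a b : R) :
  (f @ \oo --> a)%classic -> (g @ \oo --> b)%classic ->
  ((fun k => f k +i* g k : C^o) @ \oo --> (a +i* b : C^o))%classic.
Proof.
move=> fa gb.
apply/cvgrPdist_lt => -[er ei]; rewrite ltcE /= => /andP[/eqP -> e0].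
have e2 : 0 < er / 2 by lra.
move/cvgrPdist_lt: fa => /(_ _ e2) fa.
move/cvgrPdist_lt: gb => /(_ _ e2) gb.
near=> k.
have fk : `|a - f k| < er / 2 by near: k.
have gk : `|b - g k| < er / 2 by near: k.
have -> : (a +i* b : C^o) - (f k +i* g k) = (a - f k)%:C + (0 +i* (b - g k)) :> C.
  by simpc.
apply: le_lt_trans (ler_normD _ _) _.
rewrite !normc_def /= !expr0n !addr0 add0r !sqrtr_sqr.
by rewrite -rmorphD /= ltcR (splitr er) ltrD.
Unshelve. all: by end_near. Qed.

Lemma expi k : ('i%C : C) ^+ k =
  (~~ odd k)%:R * (-1) ^+ k./2 +i* ((odd k)%:R * (-1) ^+ k.-1./2).
Proof.
have even_case j : ('i%C : C) ^+ j.*2 = ((-1) ^+ j)%:C.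
  by rewrite -muln2 mulnC exprM sqr_i rmorphXn rmorphN rmorph1.
rewrite -[k]odd_double_half; case: (odd k); rewrite /= !oddD !odd_double /=.
  by rewrite add1n exprS even_case half_double /=; simpc.
by rewrite add0n even_case doubleK; simpc.
Qed.

(** The powers of i separate the exponential series into the cosine series
    (even terms) and the sine series (odd terms). *)
Lemma cvg_cis (x : R) :
  (series (fun k => k`!%:R^-1 * ('i%C * x%:C) ^+ k : C^o) @ \oo
     --> (cis x : C^o))%classic.
Proof.
have -> : series (fun k => k`!%:R^-1 * ('i%C * x%:C) ^+ k : C^o) =
  (fun n => series (cos_coeff x) n +i* series (sin_coeff x) n).
  apply/funext => n; rewrite !seriesEnat /=.
  elim: n => [|n IH]; first by rewrite !big_geq.
  rewrite !big_nat_recr //= IH.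
  rewrite exprMn -rmorphXn /= expi.
  have -> : (n`!%:R^-1 : C) = (n`!%:R^-1)%:C by rewrite fmorphV rmorph_nat.
  simpc; rewrite /cos_coeff /sin_coeff /=.
  by congr (_ +i* _); congr (_ + _); rewrite -?exprnP; ring.
apply: cvg_complex.
  by rewrite unlock; exact: is_cvg_series_cos_coeff.
by rewrite unlock; exact: is_cvg_series_sin_coeff.
Qed.

(** Each entry of the partial sums of the exponential is a fixed linear
    combination of the partial sums of the scalar exponentials. *)
Lemma expmx_diag m (A W W' : 'M[C]_m) (z E : 'I_m -> C) :
  A *m W = W *m diag_mx (\row_j z j) -> W *m W' = 1%:M ->
  (forall j, (series (fun k => k`!%:R^-1 * z j ^+ k : C^o) @ \oo
                --> (E j : C^o))%classic) ->
  expmx A = W *m diag_mx (\row_j E j) *m W'.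
Proof.
move=> AW WW' cE; apply/matrixP => u v; rewrite !mxE.
have powA k : A ^+ k = W *m diag_mx (\row_j z j ^+ k) *m W'.
  have powW : A ^+ k *m W = W *m diag_mx (\row_j z j ^+ k).
    elim: k => [|k IH].
      rewrite expr0 mul1mx; have -> : \row_j z j ^+ 0 = const_mx 1.
        by apply/rowP => j; rewrite !mxE.
      by rewrite diag_const_mx mulmx1.
    rewrite exprSr -[A ^+ k * A]/(A ^+ k *m A) -mulmxA AW mulmxA IH -mulmxA mulmx_diag.
    by congr (_ *m diag_mx _); apply/rowP => j; rewrite !mxE exprSr.
  by rewrite -powW -mulmxA WW' mulmx1.
have seriesE : series (fun k => (k`!%:R^-1 *: A ^+ k) u v : C^o) =
   (fun N => \sum_j (W u j * W' j v) *: (series (fun k => k`!%:R^-1 * z j ^+ k : C^o) N : C^o)).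
  apply/funext => N; rewrite !seriesEnat /=.
  transitivity (\sum_(0 <= k < N) \sum_j W u j * W' j v * (k`!%:R^-1 * z j ^+ k)).
    apply: eq_bigr => k _; rewrite mxE powA mxE mulr_sumr.
    by apply: eq_bigr => j _; rewrite mul_mx_diag !mxE; ring.
  by rewrite exchange_big /=; apply: eq_bigr => j _; rewrite scaler_sumr.
rewrite seriesE.
have sumE : (\sum_j (W u j * W' j v) *: (E j : C^o)) =
    \sum_j (W *m diag_mx (\row_j0 E j0)) u j * W' j v.
  by apply: eq_bigr => j _; rewrite mul_mx_diag !mxE mulrAC.
rewrite -sumE.
apply: (@cvg_lim C^o); first exact: norm_hausdorff.
apply: cvg_big => [|j _]; first exact: add_continuous.
by apply: cvgZl_tmp; exact: cE.
Qed.
End Cis.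

End Exponential.

(** * The symbol of the graph as a signed weight *)

Section Symbol.
Local Open Scope ring_scope.

Lemma gcdn_subn x n : (x <= n)%N -> gcdn (n - x) n = gcdn x n.
Proof.
by move=> xn; rewrite -{2 3}(subnK xn) gcdnDl gcdnDr gcdnC.
Qed.

Lemma val_intZ n (z : int) : (1 < n)%N ->
  (nat_of_ord (z%:~R : 'Z_n))%:Z = (z %% n%:Z)%Z.
Proof.
move=> n_gt1; have -> : z%:~R = (z %% n)%Z%:~R :> 'Z_n.
  by rewrite {1}(divz_eq z n) intrD intrM -(pmulrn _ n) pchar_Zp // mulr0 add0r.
have n0 : n%:Z != 0 by rewrite eqz_nat; lia.
have := modz_ge0 z n0; have := ltz_mod z n0.
case: (z %% n)%Z => // k; rewrite gtr0_norm ?ltz_nat; last by lia.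
by move=> kn _; rewrite -pmulrn val_Zp_nat // modn_small.
Qed.

(** With x = e k and M = e q, the gcd is e times gcd (k, 4 q), which for odd k
    is gcd (k, q). *)
Lemma gcdn_dvd_quarter M x e :
  (e %| M)%N -> (e %| x)%N -> odd (x %/ e) -> (gcdn x (4 * M) %| M)%N.
Proof.
move=> /dvdnP[q ->] /dvdnP[k ->]; have [->|e0] := posnP e; first by rewrite !muln0.
rewrite mulnK // => ok; rewrite mulnA -muln_gcdl dvdn_mul //.
by rewrite Gauss_gcdr ?dvdn_gcdr // -[4%N]/(2 ^ 2)%N coprimeXr // coprimen2.
Qed.

Section Weights.
Variables (n M : nat).
Hypotheses (M_gt0 : (0 < M)%N) (nM : n = (4 * M)%N).

(** The integer k of the definition may be taken to be x / d, because it is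
    determined modulo n / d, a multiple of 4. *)
Lemma mem_Gset r d (x : 'Z_n) : (d %| M)%N -> (r < 4)%N ->
  x \in Gset n r d = (gcdn x n == d) && ((x %/ d) %% 4 == r)%N.
Proof.
move=> dM r4; have n_gt1 : (1 < n)%N by lia.
have d_gt0 : (0 < d)%N by exact: dvdn_gt0 dM.
have [q qE] := dvdnP dM.
rewrite inE; apply/asboolP/andP => [[k [kr kd xE]]|[/eqP gE /eqP rE]].
  have := val_intZ (d%:Z * k) n_gt1; rewrite -xE => vx.
  have gx : gcdn x n = d.
    by apply/eqP; rewrite -eqz_nat -kd -[gcdz (_ * k) _]gcdz_modl -vx.
  split; first exact/eqP.
  have /dvdnP[x' x'E] : (d %| x)%N by rewrite -gx dvdn_gcdl.
  have := divz_eq (d%:Z * k) n; rewrite -vx; move: (_ %/ _)%Z => l lE.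
  have kE : k = 4 * (l * q%:Z) + x'%:Z.
    have d0 : d%:Z != 0 by lia.
    apply: (mulfI d0); rewrite lE x'E nM qE !PoszM; ring.
  by rewrite x'E mulnK //; move: (l * q%:Z) kE => p kE; lia.
have xE : (x : nat) = (d * (x %/ d))%N by rewrite mulnC divnK // -gE dvdn_gcdl.
exists (x %/ d)%:Z; split.
- by rewrite modz_nat rE; lia.
- by rewrite -PoszM -xE /gcdz /= gE.
- by rewrite -PoszM -xE -pmulrn natr_Zp.
Qed.

(** The sign function sigma, extended by 0 outside D; keeping it on natural
    numbers avoids the dependent type of [tagged G]. *)
Definition sign (G : iocg_data n) (d : nat) : int :=
  if (insub d : option (divisor (n %/ 4))) is Some dd then
    if (insub dd : option {d | d \in tag G}) is Some x
    then ssval (tagged G x) else 0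
  else 0.

Lemma quarterE : (n %/ 4 = M)%N. Proof. by rewrite nM mulKn. Qed.

Lemma divisor_dvd (d : divisor (n %/ 4)) : (ssval d %| M)%N.
Proof. by rewrite -quarterE dvdn_divisors ?quarterE //; exact: ssvalP. Qed.

Lemma sign_val (G : iocg_data n) (x : {d | d \in tag G}) :
  sign G (ssval (val x)) = ssval (tagged G x).
Proof. by rewrite /sign -[ssval _]/(val (val x)) !valK. Qed.

Lemma signP (G : iocg_data n) d :
  (sign G d = 0 /\ forall x : {d | d \in tag G}, ssval (val x) <> d) \/
  (exists2 x : {d | d \in tag G}, ssval (val x) = d & sign G d = ssval (tagged G x)).
Proof.
case: (pselect (exists x : {d | d \in tag G}, ssval (val x) = d)) => [[x <-]|no].
  by right; exists x; rewrite ?sign_val.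
left; split; last by move=> x xd; apply: no; exists x.
rewrite /sign; case: insubP => // dd _ ddE.
by case: insubP => // x _ xE; case: no; exists x; rewrite xE.
Qed.

Lemma pm1P (s : pm1) : ssval s = 1 \/ ssval s = -1.
Proof.
by case: s => s /=; rewrite !inE => /orP[] /eqP ->; [left|right].
Qed.

Lemma sign_cases G d : [\/ sign G d = 0, sign G d = 1 | sign G d = -1].
Proof.
have [[-> _]|[x _ ->]] := signP G d; first by constructor.
by case: (pm1P (tagged G x)) => ->; constructor.
Qed.

Lemma sign_dvd G d : sign G d != 0 -> (d %| M)%N.
Proof.
have [[-> _]|[x <- _ _]] := signP G d; first by rewrite eqxx.
exact: divisor_dvd.
Qed.

Definition weight (G : iocg_data n) (x : nat) : int :=
  sign G (gcdn x n) * chi4 (x %/ gcdn x n).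

Lemma mem_symbol G (x : 'Z_n) : (x \in symbol G) = (weight G x == 1).
Proof.
apply/bigcupP/eqP => [[y _ xy]|w1].
  have yM := divisor_dvd (val y).
  move: xy; rewrite /Sset /weight.
  by case: (pm1P (tagged G y)) => sE; rewrite sE /= mem_Gset // => /andP[/eqP gE /eqP kE];
     rewrite gE sign_val sE /chi4 kE.
move: w1; rewrite /weight.
have [[-> _]|[y yE ->]] := signP G (gcdn x n); first by rewrite mul0r.
have yM := divisor_dvd (val y).
move=> w1; exists y => //; rewrite /Sset.
move: w1; rewrite -yE /chi4.
case: (pm1P (tagged G y)) => ->.
  by rewrite mul1r /= mem_Gset // yE eqxx; case: ifP => // _; case: ifP.
by rewrite /= mem_Gset // yE eqxx; case: ifP => // _; case: ifP.
Qed.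

Lemma weight_cases G x : [\/ weight G x = 0, weight G x = 1 | weight G x = -1].
Proof.
rewrite /weight /chi4; case: (sign_cases G (gcdn x n)) => ->;
  case: ifP => _; try case: ifP => _; by [constructor 1|constructor 2|constructor 3].
Qed.

(** If the sign at g = gcd (x, n) is nonzero, then g divides [M], so n / g is a
    multiple of 4 and x / g, (n - x) / g have opposite characters.  Hence C and
    -C are disjoint. *)
Lemma weightN G (x : 'Z_n) : weight G (- x)%R = - weight G x.
Proof.
have n_gt1 : (1 < n)%N by lia.
have xn : (x < n)%N by rewrite -[X in (_ < X)%N](Zp_cast n_gt1).
have NxE : (nat_of_ord (- x)%R = (n - x) %% n)%N.
  have castE (y : nat) : (((Zp_trunc n).+2 - y) %% (Zp_trunc n).+2 = (n - y) %% n)%N.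
    by rewrite Zp_cast.
  exact: castE.
have gE : gcdn (- x)%R n = gcdn x n.
  by rewrite NxE gcdn_modl gcdn_subn // ltnW.
rewrite /weight gE; set g := gcdn x n.
have [->|/sign_dvd gM] := eqVneq (sign G g) 0; first by rewrite !mul0r oppr0.
rewrite -mulrN; congr (_ * _).
have [x0|x0] := posnP x.
  by move: gM; rewrite /g x0 gcd0n => /(dvdn_leq M_gt0); lia.
have /dvdnP[q qE] : (g %| M)%N by [].
have g_gt0 : (0 < g)%N by exact: dvdn_gt0 gM.
have /dvdnP[k kE] : (g %| x)%N by exact: dvdn_gcdl.
have /dvdnP[l lE] : (g %| nat_of_ord (- x)%R)%N by rewrite /g -gE dvdn_gcdl.
rewrite lE kE !mulnK //; apply: (@chi4_opp _ _ q).
apply/eqP; rewrite -(eqn_pmul2r g_gt0) mulnDl -kE -lE NxE modn_small; last by lia.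
by rewrite -mulnA -qE -nM; lia.
Qed.

(** If g = gcd (x, n) divides [M], complete multiplicativity merges
    chi4 (g / e) and chi4 (x / g) into chi4 (x / e).  If it does not, the sign
    at g is 0, and no e dividing [M] has x / e odd, since that would make g
    divide [M]; so both sides vanish. *)
Lemma weight_conv G (a : nat -> int) x :
  (forall d, (d %| M)%N -> sign G d = chi4_conv M a d) ->
  weight G x = chi4_conv M a x.
Proof.
move=> aE; rewrite /weight.
set g := gcdn x n.
have n_gt0 : (0 < n)%N by lia.
have g_gt0 : (0 < g)%N by rewrite gcdn_gt0 n_gt0 orbT.
have gx : (g %| x)%N by exact: dvdn_gcdl.
have [gM|gM] := boolP (g %| M)%N.
  rewrite aE // /chi4_conv big_distrl /=; apply: eq_big => [e|e /andP[eM eg]].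
    case: (boolP (e %| M)%N) => //= eM; rewrite dvdn_gcd.
    by have -> : (e %| n)%N; [rewrite nM dvdn_mull | rewrite andbT].
  rewrite mulrAC -chi4M; congr (chi4 _ * _).
  by rewrite mulnC muln_divA // divnK.
have -> : sign G g = 0 by apply: contraNeq gM; exact: sign_dvd.
rewrite mul0r /chi4_conv big1 // => e /andP[eM ex].
have [ox|/chi4_even -> //] := boolP (odd (x %/ e)); last by rewrite mul0r.
by case/negP: gM; rewrite /g nM; exact: gcdn_dvd_quarter ex ox.
Qed.

End Weights.

End Symbol.

(** * Spectrum of the graph *)

Section Diagonalization.
Local Open Scope ring_scope.
Local Open Scope complex_scope.

Section Root.
Variable R : realType.

Lemma cisMz (x : R) (k : int) : cis (x *~ k) = cis x ^ k.
Proof.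
case: k => k; first by rewrite -pmulrn cisMn.
by rewrite NegzE mulrNz cisN -pmulrn cisMn exprnN.
Qed.

Definition principal_root n : R[i] := cis (pi *+ 2 / n%:R).

Lemma principal_root_prim n : (0 < n)%N -> n.-primitive_root (principal_root n).
Proof.
move=> n_gt0; have nR : 0 < n%:R :> R by rewrite ltr0n.
rewrite /primitive_root_of_unity n_gt0; apply/forallP => k.
rewrite unity_rootE /principal_root -cisMn.
have [kn|kn] := eqVneq k.+1 n.
  by rewrite -(mulr_natr (_ / _)) kn divfK ?lt0r_neq0 // cisMn expr2 cis_pi mulrNN mulr1 !eqxx.
rewrite eqbF_neg; apply: cis_eq1.
have pi2 : 0 < pi *+ 2 :> R by rewrite pmulrn_lgt0 ?pi_gt0.
rewrite -(mulr_natr (_ / _)) mulrAC divr_gt0 ?mulr_gt0 ?ltr0n //.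
rewrite ltr_pdivrMr // ltr_pM2l // ltr_nat.
by rewrite ltn_neqAle kn ltn_ord.
Qed.

Lemma principal_root_quarter M : (0 < M)%N -> principal_root (4 * M) ^+ M = 'i%C.
Proof.
move=> M_gt0; rewrite /principal_root -cisMn -cis_pihalf; congr cis.
have nR : M%:R != 0 :> R by rewrite pnatr_eq0 -lt0n.
by rewrite natrM -mulr_natr; field.
Qed.
End Root.

Section Spectrum.
Variables (R : realType) (n M : nat) (G : iocg_data n) (a : nat -> int).
Hypotheses (M_gt0 : (0 < M)%N) (nM : n = (4 * M)%N).
Hypothesis aE : forall d, (d %| M)%N -> sign G d = chi4_conv M a d.

Local Notation C := R[i].
Let w : C := principal_root R n.

Let n_gt1 : (1 < n)%N. Proof. by lia. Qed.
Let n_gt0 : (0 < n)%N. Proof. by lia. Qed.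

Let w_prim : n.-primitive_root w.
Proof. exact: principal_root_prim. Qed.

Let w_quarter : w ^+ M = 'i%C.
Proof. by rewrite /w nM principal_root_quarter. Qed.

Let w_neq0 : w != 0.
Proof.
apply/eqP => w0; have /eqP := prim_expr_order w_prim.
by rewrite w0 expr0n gtn_eqF // eq_sym oner_eq0.
Qed.

Lemma adjacencyE (u v : 'Z_n) :
  hermitian_adjacency R (iocg G) u v = 'i%C * (weight G (v - u)%R)%:~R.
Proof.
rewrite mxE /iocg !(mem_symbol M_gt0 nM) -(opprB v u) (weightN M_gt0 nM).
by case: (weight_cases G (v - u)%R) => ->; rewrite /= ?mulr0 ?mulr1 ?mulrN1.
Qed.

Lemma sum_Zn (V : nmodType) (f : nat -> V) :
  \sum_(x : 'Z_n) f x = \sum_(0 <= x < n) f x.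
Proof. by rewrite -[in RHS](Zp_cast n_gt1) big_mkord. Qed.

(** Here [w ^+ M] is i, so the sum is 2 i times an integer. *)
Lemma fourier_weight j :
  \sum_(x : 'Z_n) (weight G x)%:~R * w ^+ (j * x) = 2 * 'i%C * (half_eigen M a j)%:~R.
Proof.
rewrite -w_quarter -(@fourier_conv C n M w M_gt0 nM w_prim a (weight G)).
  exact: sum_Zn.
by move=> x; exact: weight_conv.
Qed.

(** Read off from the Fourier sum, whose dependence on j is through the powers
    of a root of unity of order n. *)
Lemma half_eigen_mod j : half_eigen M a (j %% n) = half_eigen M a j.
Proof.
have i_neq0 : 2 * 'i%C != 0 :> C.
  by rewrite mulf_neq0 ?pnatr_eq0 // -w_quarter expf_neq0.
apply/eqP; rewrite -(eqr_int C); apply/eqP/(mulfI i_neq0).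
rewrite -!fourier_weight; apply: eq_bigr => x _; congr (_ * _).
by rewrite !exprM (prim_expr_mod w_prim).
Qed.

Definition dft : 'M[C]_((Zp_trunc n).+2) := \matrix_(u, j) w ^+ (u * j).
Definition dft_inv : 'M[C]_((Zp_trunc n).+2) := \matrix_(j, u) (n%:R * w ^+ (u * j))^-1.

Lemma w_expD (u v : 'Z_n) j : w ^+ ((u + v)%R * j) = w ^+ (u * j) * w ^+ (v * j).
Proof.
have -> : nat_of_ord (u + v)%R = ((u + v) %% n)%N.
  have castE (y : nat) : (y %% (Zp_trunc n).+2 = y %% n)%N by rewrite Zp_cast.
  exact: castE.
by rewrite exprM (prim_expr_mod w_prim) -exprM mulnDl exprD.
Qed.

Lemma w_inj (u v : 'Z_n) : w ^+ u = w ^+ v -> u = v.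
Proof.
move=> /eqP; rewrite (eq_prim_root_expr w_prim) => /eqP uv; apply: val_inj => /=.
have lt (x : 'Z_n) : (x < n)%N by rewrite -[X in (_ < X)%N](Zp_cast n_gt1).
by move: uv; rewrite !modn_small.
Qed.

Lemma dftK : dft *m dft_inv = 1%:M.
Proof.
have nC : n%:R != 0 :> C by rewrite pnatr_eq0 -lt0n.
apply/matrixP => u v; rewrite !mxE.
transitivity (n%:R^-1 * \sum_(0 <= j < n) (w ^+ u / w ^+ v) ^+ j).
  rewrite -sum_Zn mulr_sumr; apply: eq_bigr => j _.
  rewrite !mxE invfM mulrCA; congr (_ * _).
  by rewrite exprMn exprVn -!exprM.
rewrite sum_roots_of_unity; last first.
  by rewrite exprMn exprVn -!exprM ![(_ * n)%N]mulnC !exprM (prim_expr_order w_prim) !expr1n divr1.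
have wv : w ^+ v != 0 by rewrite expf_neq0.
rewrite -(inj_eq (mulIf wv)) divfK // mul1r.
have [->|uv] := eqVneq u v; first by rewrite eqxx mulVf.
by case: eqP => [/w_inj /eqP|_]; rewrite ?(negPf uv) ?mulr0.
Qed.

(** The columns of the transform are eigenvectors, as for every circulant
    matrix; the two factors i, one from H and one from [fourier_weight],
    make the eigenvalue real. *)
Lemma adjacency_dft (t : R) :
  (('i%C * t%:C) *: hermitian_adjacency R (iocg G)) *m dft =
  dft *m diag_mx (\row_j ('i%C * (- t *+ 2 *~ half_eigen M a (nat_of_ord j))%:C)).
Proof.
apply/matrixP => u j; rewrite mul_mx_diag !mxE.
under eq_bigr => v _ do rewrite mxE adjacencyE mxE.
rewrite (reindex_inj (addIr u)).
transitivity (\sum_(x : 'Z_n) ('i%C * t%:C * 'i%C * w ^+ (u * j)) *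
                ((weight G x)%:~R * w ^+ (j * x))).
  apply: eq_bigr => x _; rewrite addrK w_expD [(j * x)%N]mulnC; ring.
rewrite -mulr_sumr fourier_weight.
rewrite rmorphMz rmorphMn rmorphN -mulr_natr -mulrzr /=.
have := sqr_i R; set ii := 'i%C => i2.
transitivity (ii * w ^+ (u * j) * t%:C * (half_eigen M a j)%:~R * 2 * ii ^+ 2); first by ring.
by rewrite i2; ring.
Qed.

Lemma transitionE (t : R) :
  transition (iocg G) t =
  dft *m diag_mx (\row_j (cis (- t *+ 2) ^ half_eigen M a (nat_of_ord j))) *m dft_inv.
Proof.
rewrite /transition; apply: (expmx_diag (adjacency_dft t) dftK) => j.
by rewrite -cisMz; exact: cvg_cis.
Qed.

(** The condition is the equation of vectors in the Fourier basis.  It is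
    stated for all natural j, rather than for j < n, so that it can be used at
    j + 2 m; periodicity in j makes the two forms equivalent. *)
Lemma pst_betweenP (u v : 'Z_n) :
  pst_between R (iocg G) u v <->
  exists (t : R) (gamma : C), `|gamma| = 1 /\
    forall j : nat, cis (- t *+ 2) ^ half_eigen M a j * w ^+ (v * j) = gamma * w ^+ (u * j).
Proof.
have nC : n%:R != 0 :> C by rewrite pnatr_eq0 -lt0n.
have wn0 k : w ^+ k != 0 by rewrite expf_neq0.
split=> -[t [gamma [g1 tE]]]; exists t, gamma; split => //.
  move=> j; pose j' : 'Z_n := inZp j.
  have j'E : nat_of_ord j' = (j %% n)%N.
    have castE (y : nat) : (y %% (Zp_trunc n).+2 = y %% n)%N by rewrite Zp_cast.
    exact: castE.
  have := congr1 (fun X => (dft_inv *m X) j' 0) tE.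
  rewrite transitionE !mulmxA (mulmx1C dftK) mul1mx -mulmxA -scalemxAr -!colE.
  rewrite mul_diag_mx !mxE j'E half_eigen_mod => h.
  have wE (x : 'Z_n) : w ^+ (x * j) = w ^+ (x * (j %% n)).
    by rewrite ![(x * _)%N]mulnC -[in RHS](prim_expr_mod w_prim) modnMml (prim_expr_mod w_prim).
  rewrite !wE; move: h; rewrite !invfM => h.
  have unz := invr_neq0 (wn0 (u * (j %% n))%N).
  have vnz := invr_neq0 (wn0 (v * (j %% n))%N).
  apply: (mulIf (mulf_neq0 (invr_neq0 nC) (mulf_neq0 unz vnz))).
  transitivity (cis (- t *+ 2) ^ half_eigen M a j * (n%:R^-1 / w ^+ (u * (j %% n)))).
    by rewrite mulrAC; field; rewrite nC !wn0.
  by rewrite h; field; rewrite nC !wn0.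
rewrite transitionE -!mulmxA -[gamma *: _]mul1mx -dftK -mulmxA; congr (_ *m _).
apply/colP => j; rewrite -scalemxAr -!colE mul_diag_mx !mxE !invfM.
apply: (mulIf (mulf_neq0 nC (mulf_neq0 (wn0 (u * j)%N) (wn0 (v * j)%N)))).
transitivity (cis (- t *+ 2) ^ half_eigen M a j * w ^+ (v * j)).
  by field; rewrite nC !wn0.
by rewrite tE; field; rewrite nC !wn0.
Qed.
End Spectrum.

End Diagonalization.

(** * Which graphs have perfect state transfer *)

Section Transfer.
Local Open Scope ring_scope.
Local Open Scope complex_scope.

Lemma expN1z (F : unitRingType) (x : int) :
  (-1 : F) ^ x = (-1) ^+ (x%:~R != 0 :> 'F_2).
Proof.
have nat_case k : (-1 : F) ^+ k = (-1) ^+ (k%:R != 0 :> 'F_2).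
  by rewrite -(signr_odd _ k) F2_natr; case: (odd k).
case: x => k; first by rewrite -pmulrn -nat_case.
by rewrite NegzE mulrNz oppr_eq0 -exprnN -pmulrn nat_case; case: (_ != _); rewrite ?invrN invr1.
Qed.

Lemma neg1_neq1 (F : numDomainType) : (-1 : F) != 1.
Proof. by rewrite eq_sym -subr_eq0 opprK -[1 + 1]/(2%:R) pnatr_eq0. Qed.

(** The number z ^ (x y) is (-1) ^ y and also (-1) ^ x. *)
Lemma same_parity (F : numFieldType) (z : F) (x y : int) :
  z ^ x = -1 -> z ^ y = -1 -> x%:~R = y%:~R :> 'F_2.
Proof.
move=> zx zy; have : z ^ (x * y) = z ^ (y * x) by rewrite mulrC.
rewrite -!exprz_exp zx zy !expN1z.
have F2P (c : 'F_2) : c = (c != 0)%:R.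
  by case: c => [[|[|?]] ?] //; apply: val_inj.
move: (F2P x%:~R) (F2P y%:~R).
by case: (x%:~R != 0); case: (y%:~R != 0) => -> -> // /eqP;
   rewrite ?(negPf (neg1_neq1 _)) // eq_sym (negPf (neg1_neq1 _)).
Qed.

Section Criterion.
Variables (R : realType) (n M : nat) (G : iocg_data n).
Hypotheses (M_gt0 : (0 < M)%N) (nM : n = (4 * M)%N).

(** The left-to-right direction follows from the antiperiodicity of the
    eigenvalues, which leaves only transfers by a fourth root of unity, and from
    the parity of the eigenvalues; the other direction is the transfer from 0
    to n / 2 at a quarter period. *)
Lemma has_pstP : has_pst R (iocg G) <->
  forall d, (d %| M)%N -> odd (M %/ d) -> (sign G d != 0) = (d == M).
Proof.
have [a aE] := chi4_inversion M_gt0 (sign G).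
have n_gt1 : (1 < n)%N by lia.
have n_gt0 : (0 < n)%N by lia.
pose w : R[i] := principal_root R n.
have w_prim : n.-primitive_root w by exact: principal_root_prim.
have w2M : w ^+ (2 * M) = -1.
  by rewrite mulnC exprM (quarter_root_sqr M_gt0 nM w_prim).
split=> [[u [v [uv]]]|dE]; last first.
  have LE : forall j, odd j -> (half_eigen M a j)%:~R = 1 :> 'F_2.
    apply: (half_eigen_of_coef M_gt0); apply: (coef_of_value M_gt0 aE) => d dM od.
    have := dE d dM od; case: (d == M :> nat); last by move/eqP ->.
    by case: (sign_cases G d) => -> // _; apply: val_inj.
  exists 0, (inZp (2 * M)).
  have valM : nat_of_ord (inZp (2 * M) : 'Z_n) = (2 * M)%N.
    have castE (y : nat) : (y %% (Zp_trunc n).+2 = y %% n)%N by rewrite Zp_cast.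
    by rewrite /= castE modn_small //; lia.
  split.
    by apply/eqP => /(congr1 (@nat_of_ord _)); rewrite valM /=; lia.
  apply/(pst_betweenP R M_gt0 nM aE); exists (- (pi / 2)), 1; split; first by rewrite normr1.
  move=> j; rewrite valM mul0n mulr1 exprM -/w w2M opprK.
  have -> : pi / 2 *+ 2 = pi :> R by rewrite -mulr_natr divfK ?pnatr_eq0.
  rewrite cis_pi expN1z -(signr_odd _ j).
  have [oj|ej] := boolP (odd j); first by rewrite LE // oner_neq0 mulrNN mulr1.
  by rewrite half_eigen_even // eqxx mulr1.
move/(pst_betweenP R M_gt0 nM aE) => [t [gamma [_ tE]]].
move: tE; set z := cis _; rewrite -/(principal_root R n) -/w => tE.
have gamma1 : gamma = 1 by have := tE 0%N; rewrite half_eigen0 !muln0 !mulr1 expr0z => ->.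
have w_neq0 : w != 0.
  apply/eqP => w0; have /eqP := prim_expr_order w_prim.
  by rewrite w0 expr0n gtn_eqF // eq_sym oner_eq0.
pose zeta := w ^+ u / w ^+ v.
have zetaE j : z ^ half_eigen M a j = zeta ^+ j.
  rewrite exprMn exprVn -!exprM; apply: canRL (mulfK _) _; first by rewrite expf_neq0.
  by rewrite tE gamma1 mul1r.
have zeta_neq1 : zeta != 1.
  apply: contra uv => /eqP z1; apply/eqP/(w_inj (R := R) M_gt0 nM); rewrite -/w.
  by rewrite -[LHS](divfK (expf_neq0 v w_neq0)) -/zeta z1 mul1r.
have zeta_neq0 : zeta != 0 by rewrite mulf_neq0 ?invr_eq0 ?expf_neq0.
have [m m_odd dvd_m] : exists2 m, odd m & forall q, (q %| M)%N -> odd q -> (q %| m)%N.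
  exists (M`_2^')%N; last by move=> q qM oq; rewrite dvdn_oddpart ?qM.
  by have := dvdnn (M`_2^')%N; rewrite dvdn_oddpart // => /andP[].
have shift j : odd j -> zeta ^+ (2 * (j + m)) = 1.
  move=> oj; have := zetaE (j + 2 * m)%N; rewrite (half_eigen_antiperiod a m_odd oj dvd_m).
  rewrite -invr_expz zetaE => h.
  have -> : (2 * (j + m) = j + (j + 2 * m))%N by lia.
  by rewrite exprD -h mulfV // expf_neq0.
have zeta4 : zeta ^+ 4 = 1.
  have := shift 3 isT; have -> : (2 * (3 + m) = 4 + 2 * (1 + m))%N by lia.
  by rewrite exprD shift // mulr1.
(* If zeta is a primitive fourth root of unity, doubling the time replaces it
   by its square, which is -1. *)
have [z' z'E] : exists z' : R[i], forall j, odd j -> z' ^ half_eigen M a j = -1.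
  have sqr_case (y : R[i]) : y != 1 -> y ^+ 2 = 1 -> y = -1.
    by move=> y1 /eqP; rewrite sqrf_eq1 (negPf y1) => /eqP.
  have [z2|z2] := eqVneq (zeta ^+ 2) 1.
    exists z => j oj; rewrite zetaE (sqr_case zeta) //.
    by rewrite -(signr_odd _ j) oj.
  exists (z ^ 2) => j oj; rewrite exprz_exp mulrC -exprz_exp zetaE.
  rewrite -exprnP -exprM mulnC exprM (sqr_case (zeta ^+ 2)) -?exprM //.
  by rewrite -(signr_odd _ j) oj.
have Lc j : odd j -> (half_eigen M a j)%:~R = (half_eigen M a 1)%:~R :> 'F_2.
  by move=> oj; apply: (same_parity (z'E _ oj)); exact: z'E.
have vE := value_of_coef M_gt0 aE (coef_of_half_eigen M_gt0 Lc).
have signF2 d : ((sign G d)%:~R == 0 :> 'F_2) = (sign G d == 0).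
  by case: (sign_cases G d) => ->.
have [L0|L1] := eqVneq ((half_eigen M a 1)%:~R : 'F_2) 0.
  have v0 d : (d %| M)%N -> odd (M %/ d) -> sign G d = 0.
    by move=> dM od; apply/eqP; rewrite -signF2 vE // L0 mul0rn.
  have := z'E 1%N isT; rewrite (half_eigen_eq0 M_gt0 aE v0) // expr0z => /eqP.
  by rewrite eq_sym (negPf (neg1_neq1 _)).
move=> d dM od; rewrite -signF2 vE //.
by case: (d == M :> nat); rewrite ?mulr0n ?eqxx.
Qed.
End Criterion.

End Transfer.

(** * Counting *)

Lemma oddpart_quarter n M : (0 < M)%N -> n = 4 * M -> n %/ 2 ^ logn 2 n = M`_2^'.
Proof.
move=> M_gt0 nM; have n_gt0 : 0 < n by lia.
rewrite -p_part -{1}(partnC 2 n_gt0) mulKn ?part_gt0 // nM partnM //.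
by rewrite (@part_p'nat 2^' 4) ?mul1n // pnatNK.
Qed.

(** The involution d -> M / d maps these divisors to the odd divisors of [M]. *)
Lemma count_odd_codivisors M : (0 < M)%N ->
  count (fun d => odd (M %/ d)) (divisors M) = tau M`_2^'.
Proof.
move=> M_gt0; rewrite -size_filter /tau -[RHS](size_map (fun q => M %/ q)).
have m_gt0 := part_gt0 2^' M.
apply/perm_size/uniq_perm.
- by rewrite filter_uniq ?divisors_uniq.
- rewrite map_inj_in_uniq ?divisors_uniq // => p q.
  rewrite -!dvdn_divisors // !dvdn_oddpart // => /andP[pM _] /andP[qM _] h.
  have /eqP : M %/ q * p = M %/ q * q by rewrite -{1}h !divnK.
  have q_gt0 : 0 < q := dvdn_gt0 M_gt0 qM.
  by rewrite eqn_pmul2l ?divn_gt0 ?(dvdn_leq M_gt0 qM) // => /eqP.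
move=> d; rewrite mem_filter -dvdn_divisors //; apply/andP/mapP => [[od dM]|[q]].
  exists (M %/ d); last by rewrite divnA ?mulKn.
  by rewrite -dvdn_divisors // dvdn_oddpart // dvdn_div.
rewrite -dvdn_divisors // dvdn_oddpart // => /andP[qM oq] ->.
by rewrite dvdn_div // divnA // mulKn.
Qed.

Section Count.
Variables (n M : nat).
Hypotheses (M_gt0 : (0 < M)%N) (nM : n = (4 * M)%N).
Local Notation T := (divisor (n %/ 4)).

Definition admissible (D : {set T}) :=
  [forall d : T, odd (M %/ ssval d) ==> ((d \in D) == (ssval d == M))].

Lemma sign_neq0 G (d : T) : (sign G (ssval d) != 0%R) = (d \in tag G).
Proof.
apply/idP/idP => [|dG].
  have [[-> _]|[x xd _] _] := signP G (ssval d); first by rewrite eqxx.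
  have <- : val x = d by apply: val_inj; exact: xd.
  exact: valP.
pose x : {d | d \in tag G} := Sub d dG.
by rewrite (sign_val x : sign G (ssval d) = _); case: (pm1P (tagged G x)) => ->.
Qed.

Lemma pst_admissible (R : realType) (G : iocg_data n) :
  (tag G != set0) && `[< has_pst R (iocg G) >] = admissible (tag G).
Proof.
apply/andP/forallP => [[_ /asboolP /(has_pstP R G M_gt0 nM) pst] d|adm].
  apply/implyP => od; rewrite -sign_neq0 pst //; exact: divisor_dvd.
have dvdM d : (d %| M) -> d \in divisors (n %/ 4).
  by rewrite (quarterE nM) -dvdn_divisors.
split.
  have := adm (Sub M (dvdM M (dvdnn M)) : T).
  rewrite /= divnn M_gt0 /= eqxx => /eqP MG.
  by apply/set0Pn; eexists; exact: MG.
apply/asboolP/(has_pstP R G M_gt0 nM) => d dM od.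
have := adm (Sub d (dvdM d dM) : T).
by rewrite /= od /= -sign_neq0 => /eqP.
Qed.

(** Each divisor in D carries one of two signs. *)
Lemma card_iocg (p : pred {set T}) :
  #|[pred G : iocg_data n | p (tag G)]| = \sum_(D : {set T} | p D) 2 ^ #|D|.
Proof.
rewrite -sum1_card.
transitivity (\sum_(D : {set T} | p D) \sum_(f : {ffun {d | d \in D} -> pm1} | true) 1).
  rewrite sig_big_dep /=.
  by apply: eq_bigl => G; rewrite inE andbT.
apply: eq_bigr => D _; rewrite sum1_card card_ffun card_sig.
by rewrite card_seq_sub.
Qed.

Let M_divisor : M \in divisors (n %/ 4).
Proof. by rewrite (quarterE nM) -dvdn_divisors. Qed.

(** Summing over D a product of local factors gives the product over d of
    (factor if d is in D) + (factor if not); admissibility is local, with total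
    factor 2 at d = M, 1 at the other d with M / d odd, and 3 elsewhere. *)
Lemma sum_admissible :
  \sum_(D : {set T} | admissible D) 2 ^ #|D| =
  2 * 3 ^ #|[pred d : T | ~~ odd (M %/ ssval d)]|.
Proof.
pose A (d : T) := if odd (M %/ ssval d) && (ssval d != M) then 0 else 2.
pose B (d : T) := if odd (M %/ ssval d) && (ssval d == M) then 0 else 1.
transitivity (\prod_(d : T) (A d + B d)); last first.
  transitivity (\prod_(d : T) ((if ssval d == M then 2 else 1) *
                               (if ~~ odd (M %/ ssval d) then 3 else 1))).
    apply: eq_bigr => d _; rewrite /A /B.
    have [->|_] := eqVneq (ssval d) M; first by rewrite divnn M_gt0.
    by case: odd.
  rewrite big_split -!big_mkcond /=.
  by rewrite (big_pred1 (Sub M M_divisor : T)) // prod_nat_const.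
rewrite bigA_distr big_mkcond; apply: eq_bigr => D _.
case: ifP => [/forallP adm|/negbT].
  transitivity (\prod_(d : T) (if d \in D then 2 else 1)).
    by rewrite -big_mkcond prod_nat_const.
  apply: eq_bigr => d _; have := adm d; rewrite /A /B.
  by case: odd => //= /eqP ->; case: eqP.
rewrite negb_forall => /existsP[d].
rewrite negb_imply => /andP[od dD]; rewrite (bigD1 d) //= /A /B od /=.
by move: dD; case: (d \in D); case: (ssval d == M).
Qed.

Lemma card_even : #|[pred d : T | ~~ odd (M %/ ssval d)]| = tau M - tau M`_2^'.
Proof.
have permT : perm_eq [seq ssval d | d <- enum T] (divisors M).
  apply: uniq_perm; rewrite ?divisors_uniq //.
    by rewrite (map_inj_uniq val_inj) enum_uniq.
  move=> d; rewrite -(quarterE nM); apply/mapP/idP => [[x _ ->]|dM]; first exact: ssvalP.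
  by exists (Sub d dM); rewrite ?mem_enum.
rewrite -(count_odd_codivisors M_gt0) /tau -(count_predC (fun d => odd (M %/ d))) addKn.
rewrite -(permP permT) count_map cardE /enum_mem size_filter count_filter.
by apply: eq_count => d; rewrite /= !inE andbT.
Qed.
End Count.

Theorem corollary3p7 (R : realType) (n : nat) (n_gt0 : (0 < n)%N)
    (n_mod4 : (4 %| n)%N) :
  #|[pred G : iocg_data n | (tag G != set0) && `[< has_pst R (iocg G) >]]|
  = (2 * 3 ^ (tau (n %/ 4) - tau (n %/ 2 ^ logn 2 n)))%N.
Proof.
have nM : n = 4 * (n %/ 4) by rewrite mulnC divnK.
have M_gt0 : 0 < n %/ 4 by rewrite divn_gt0 // dvdn_leq.
rewrite (oddpart_quarter M_gt0 nM) -(card_even M_gt0 nM) -(sum_admissible M_gt0 nM).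
rewrite -card_iocg; apply: eq_card => G; rewrite !inE.
exact: pst_admissible.
Qed.
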